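(* Let $I$ be an index set, and for each $i\in I$ let $X_i$ be an $R_0$ hereditarily Baire space with a base of countable order. Then $\prod_{i\in I}X_i$ (product topology) is a Baire space.
   Context: A space is Baire if countable intersections of dense open sets are dense; hereditarily Baire if every nonempty closed subspace is Baire; $R_0$ if every open set contains the closure of each of its points. A base $\mathcal B$ of a space is a base of countable order (BCO) if every strictly decreasing sequence of members of $\mathcal B$ all containing a point $x$ forms a neighborhood base at $x$. *)

(* Defs.v *)
From Stdlib Require Import List.

Set Implicit Arguments.

Definition opens (X : Type) := (X -> Prop) -> Prop.

Definition is_topology (X : Type) (opn : opens X) : Prop :=
  opn (fun _ => True) /\
  (forall U V, opn U -> opn V -> opn (fun x => U x /\ V x)) /\
  (forall F : (X -> Prop) -> Prop,
      (forall U, F U -> opn U) -> opn (fun x => exists U, F U /\ U x)).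

Definition closed_set (X : Type) (opn : opens X) (F : X -> Prop) : Prop :=
  opn (fun x => ~ F x).

Definition closure (X : Type) (opn : opens X) (A : X -> Prop) (x : X) : Prop :=
  forall U, opn U -> U x -> exists y, U y /\ A y.

Definition dense (X : Type) (opn : opens X) (A : X -> Prop) : Prop :=
  forall x, closure opn A x.

Definition Baire (X : Type) (opn : opens X) : Prop :=
  forall D : nat -> X -> Prop,
    (forall n, opn (D n)) -> (forall n, dense opn (D n)) ->
    dense opn (fun x => forall n, D n x).

Definition subspace_open (X : Type) (opn : opens X) (F : X -> Prop)
  : opens {x : X | F x} :=
  fun W => exists U, opn U /\ forall y : {x : X | F x}, W y <-> U (proj1_sig y).

Definition hereditarily_Baire (X : Type) (opn : opens X) : Prop :=
  forall F : X -> Prop, closed_set opn F -> (exists x, F x) ->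
    Baire (subspace_open opn F).

Definition R0_space (X : Type) (opn : opens X) : Prop :=
  forall U x, opn U -> U x -> forall y, closure opn (fun z => z = x) y -> U y.

Definition is_base (X : Type) (opn : opens X) (B : (X -> Prop) -> Prop) : Prop :=
  (forall b, B b -> opn b) /\
  (forall U x, opn U -> U x -> exists b, B b /\ b x /\ forall y, b y -> U y).

Definition strict_subset (X : Type) (A B : X -> Prop) : Prop :=
  (forall y, A y -> B y) /\ exists y, B y /\ ~ A y.

Definition nbhd (X : Type) (opn : opens X) (N : X -> Prop) (x : X) : Prop :=
  exists U, opn U /\ U x /\ forall y, U y -> N y.

Definition nbhd_base_seq (X : Type) (opn : opens X) (b : nat -> X -> Prop) (x : X) : Prop :=
  (forall n, nbhd opn (b n) x) /\
  (forall N, nbhd opn N x -> exists n, forall y, b n y -> N y).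

Definition base_countable_order (X : Type) (opn : opens X) (B : (X -> Prop) -> Prop) : Prop :=
  is_base opn B /\
  forall (b : nat -> X -> Prop) (x : X),
    (forall n, B (b n)) -> (forall n, strict_subset (b (S n)) (b n)) ->
    (forall n, b n x) -> nbhd_base_seq opn b x.

Definition has_BCO (X : Type) (opn : opens X) : Prop :=
  exists B, base_countable_order opn B.

(* product topology on forall i, X i: generated by basic boxes
   prod_i V_i with V_i open and V_i = X_i except for finitely many i *)
Definition product_open (I : Type) (X : I -> Type) (opn : forall i, opens (X i))
  : opens (forall i, X i) :=
  fun U => forall f, U f ->
    exists (l : list I) (V : forall i, X i -> Prop),
      (forall i, opn i (V i)) /\ (forall i, V i (f i)) /\
      (forall g, (forall i, In i l -> V i (g i)) -> U g).

(* Main.v *)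
Require Import Defs.
From Stdlib Require Import List Arith Cantor.
From Stdlib Require Import Classical ClassicalEpsilon.
From Stdlib Require Import FunctionalExtensionality PropExtensionality.

Set Implicit Arguments.

(** A base of countable order makes every factor first countable.
    By a Löwenheim–Skolem closing-off one gets countable sets [C i] in the
    factors such that every finite box built from countable neighborhood bases at points of the [C i] meets each dense open
    set [D n] in a point with coordinates in the [C i].  The closures of the
    [C i] are Baire and have countable pi-bases, so coordinates can be fixed one
    at a time, as in Oxtoby's theorem on products of Baire spaces with countable
    pi-bases, keeping all the sections of the [D n] dense. *)

(** * Choice principles *)

(** [R] depends on the stage so that step [n] can treat the [n]-th dense set; [P] is the invariant
    that keeps the next choice possible. *)
Lemma dependent_choice (A : Type) (P : A -> Prop) (R : nat -> A -> A -> Prop) (a0 : A) :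
  P a0 -> (forall n a, P a -> exists a', P a' /\ R n a a') ->
  exists f : nat -> A, forall n, P (f n) /\ R n (f n) (f (S n)).
Proof.
  intros H0 HS.
  set (next := fun n a => epsilon (inhabits a0) (fun a' => P a' /\ R n a a')).
  set (f := nat_rect (fun _ => A) a0 next).
  assert (HP : forall n, P (f n)).
  { induction n as [|n IH]; [exact H0|].
    exact (proj1 (epsilon_spec (inhabits a0) _ (HS n (f n) IH))). }
  exists f; intro n; split; [apply HP|].
  exact (proj2 (epsilon_spec (inhabits a0) _ (HS n (f n) (HP n)))).
Qed.

(** Index equality is decided classically and [x] transported along it; proof irrelevance makes the
    transport at [i] itself trivial. *)
Lemma dependent_update (I : Type) (X : I -> Type) (g : forall i, X i) (i : I) (x : X i) :
  exists g' : forall j, X j, g' i = x /\ forall j, j <> i -> g' j = g j.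
Proof.
  exists (fun j => match excluded_middle_informative (i = j) with
                   | left e => eq_rect i X x j e
                   | right _ => g j
                   end).
  split.
  - destruct (excluded_middle_informative (i = i)) as [e|n]; [|now destruct n].
    now rewrite (proof_irrelevance _ e eq_refl).
  - intros j Hj.
    destruct (excluded_middle_informative (i = j)) as [e|n]; [|reflexivity].
    now destruct Hj.
Qed.

(** * First countability, and Baire category in closures *)

Section Topology.

Variables (X : Type) (opn : opens X).
Hypothesis topo : is_topology opn.

Lemma open_ext (U V : X -> Prop) : (forall x, U x <-> V x) -> opn U -> opn V.
Proof.
  intros H HU.
  replace V with U; [exact HU|].
  apply functional_extensionality; intro x.
  now apply propositional_extensionality.
Qed.

Lemma open_const (P : Prop) : opn (fun _ => P).
Proof.
  destruct topo as (HT & _ & HF).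
  destruct (classic P) as [p|np].
  - now apply open_ext with (2 := HT).
  - apply open_ext with (2 := HF (fun _ => False) (fun _ h => False_ind _ h)).
    intro x; split; [intros [U [[] _]]|tauto].
Qed.

Lemma open_inter (U V : X -> Prop) : opn U -> opn V -> opn (fun x => U x /\ V x).
Proof. apply topo. Qed.

Lemma open_of_nbhd (V : X -> Prop) : (forall x, V x -> nbhd opn V x) -> opn V.
Proof.
  intro H.
  destruct topo as (_ & _ & HF).
  apply open_ext with (2 := HF (fun U => opn U /\ forall y, U y -> V y) (fun U h => proj1 h)).
  intro x; split.
  - now intros [U [[_ h] hx]]; apply h.
  - intros hx. destruct (H x hx) as [U (hU & hUx & hUV)]. now exists U.
Qed.

Lemma closed_closure (A : X -> Prop) : closed_set opn (closure opn A).
Proof.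
  apply open_of_nbhd; intros x Hx.
  apply not_all_ex_not in Hx; destruct Hx as [U HU].
  apply imply_to_and in HU; destruct HU as [HU H].
  apply imply_to_and in H; destruct H as [HUx H].
  exists U; split; [exact HU|split; [exact HUx|]].
  intros y Hy Hcl. now destruct (Hcl U HU Hy) as [z Hz]; apply H; exists z.
Qed.

(** Either one base member at [x] lies inside all others and alone is a neighborhood base, or each
    can be strictly shrunk, which yields a strictly decreasing sequence for the BCO condition. *)
Lemma BCO_first_countable (x : X) :
  has_BCO opn ->
  exists b : nat -> X -> Prop,
    (forall m, opn (b m)) /\ (forall m, b m x) /\
    (forall U, opn U -> U x -> exists m, forall y, b m y -> U y).
Proof.
  intros [B [[Bopen Bbase] Border]].
  destruct (classic (exists b, B b /\ b x /\
    forall b', B b' -> b' x -> forall y, b y -> b' y)) as [(b & Hb & Hbx & Hmin)|Hno].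
  - exists (fun _ => b); split; [now auto|split; [now auto|]].
    intros U HU HUx. destruct (Bbase U x HU HUx) as (b' & Hb' & Hb'x & Hb'U).
    exists 0; intros y Hy; apply Hb'U; now apply (Hmin b').
  - destruct (Bbase (fun _ => True) x (proj1 topo) Logic.I) as (b0 & Hb0 & Hb0x & _).
    destruct (@dependent_choice (X -> Prop) (fun b => B b /\ b x)
                (fun _ b b' => strict_subset b' b) b0) as [b Hb].
    + now split.
    + intros _ b [Hb Hbx].
      destruct (classic (exists b', B b' /\ b' x /\ exists y, b y /\ ~ b' y))
        as [(b' & Hb' & Hb'x & y & Hy & Hny)|Hn].
      * destruct (Bbase (fun z => b z /\ b' z) x) as (b2 & Hb2 & Hb2x & Hsub);
          [now apply open_inter; apply Bopen|now split|].
        exists b2; split; [now split|split].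
        -- intros z Hz; now apply Hsub.
        -- exists y; split; [exact Hy|]. intro Hz; now apply Hny, Hsub.
      * exfalso; apply Hno; exists b; split; [exact Hb|split; [exact Hbx|]].
        intros b' Hb' Hb'x y Hy; apply NNPP; intro Hny.
        apply Hn; exists b'; repeat split; trivial; now exists y.
    + destruct (Border b x (fun n => proj1 (proj1 (Hb n))) (fun n => proj2 (Hb n))
                  (fun n => proj2 (proj1 (Hb n)))) as [_ Hnb].
      exists b; split; [intro n; apply Bopen, Hb|split; [intro n; exact (proj2 (proj1 (Hb n)))|]].
      intros U HU HUx. apply Hnb. now exists U.
Qed.

(** Baire category in the closed subspace [closure opn C]. Every nonempty relatively open set
    contains a point of [C], so density is tested only around such points. *)
Lemma hereditarily_Baire_closure (C : X -> Prop) (E : nat -> X -> Prop) (W : X -> Prop) :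
  hereditarily_Baire opn ->
  (forall n, opn (E n)) ->
  (forall n V c, opn V -> C c -> V c -> exists x, closure opn C x /\ V x /\ E n x) ->
  opn W -> (exists c, C c /\ W c) ->
  exists x, closure opn C x /\ W x /\ forall n, E n x.
Proof.
  intros HB HE Hdense HW [c [Hc HWc]].
  assert (Hcl : closure opn C c) by (intros U _ HU; now exists c).
  assert (HBC := HB _ (closed_closure C) (ex_intro _ c Hcl)).
  destruct (HBC (fun n y => E n (proj1_sig y))) with
    (x := exist (closure opn C) c Hcl) (U := fun y : {x | closure opn C x} => W (proj1_sig y))
    as [[x Hx] [HWx HEx]].
  - intro n; now exists (E n).
  - intros n [y Hy] O [V [HV HOV]] HO.
    destruct (Hy V HV) as [c' [HVc' Hc']]; [now apply HOV in HO|].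
    destruct (Hdense n V c' HV Hc' HVc') as (x & Hx & HVx & HEx).
    exists (exist _ x Hx); split; [now apply HOV|exact HEx].
  - now exists W.
  - exact HWc.
  - exists x; auto.
Qed.

End Topology.

(** * Boxes in the product as finite lists of conditions *)

Section Product.

Unset Implicit Arguments.

Variables (I : Type) (X : I -> Type) (opn : forall i, opens (X i)).
Hypothesis topo : forall i, is_topology (opn i).
Hypothesis hBaire : forall i, hereditarily_Baire (opn i).

Variable b : forall i, X i -> nat -> X i -> Prop.
Hypothesis b_open : forall i x m, opn i (b i x m).
Hypothesis b_center : forall i x m, b i x m x.
Hypothesis b_base : forall i x U, opn i U -> U x -> exists m, forall y, b i x m y -> U y.

Variable D : nat -> (forall i, X i) -> Prop.
Hypothesis D_open : forall n, product_open X opn (D n).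
Hypothesis D_dense : forall n, dense (product_open X opn) (D n).

Set Implicit Arguments.

(* The condition [(i, f, m)] on [g] says that [g i] is in the [m]-th
   neighborhood of [f i]. *)
Definition condition := (I * (forall i, X i) * nat)%type.

Definition meets_on (s : list I) (g : forall i, X i) (q : list condition) : Prop :=
  forall i f m, In (i, f, m) q -> In i s -> b i (f i) m (g i).

Definition meets (g : forall i, X i) (q : list condition) : Prop :=
  forall i f m, In (i, f, m) q -> b i (f i) m (g i).

Lemma meets_coordinate_open (i : I) (q : list condition) :
  opn i (fun x => forall f m, In (i, f, m) q -> b i (f i) m x).
Proof.
  induction q as [|[[j f'] m'] q IH].
  - apply (open_ext _ (fun _ => True)); [|now apply open_const].
    intro x; split; [intros _ f m []|trivial].
  (* Evaluating [f'] at [i] instead of [j] avoids a transport along [j = i]; a condition carries a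
     whole point of the product, so this makes sense. *)
  - apply (open_ext _ (fun x => (j = i -> b i (f' i) m' x) /\
                                  forall f m, In (i, f, m) q -> b i (f i) m x)).
    + intro x; split.
      * intros [H1 H2] f m [e|Hin]; [|now apply H2].
        injection e as -> -> ->; now apply H1.
      * intros H; split; [intros ->; apply H; now left|].
        intros f m Hin; apply H; now right.
    + apply open_inter; [apply topo| |exact IH].
      destruct (classic (j = i)) as [e|ne].
      * apply (open_ext _ (b i (f' i) m')); [intro; tauto|apply b_open].
      * apply (open_ext _ (fun _ => True)); [intro; tauto|now apply open_const].
Qed.

Lemma meets_open (q : list condition) : product_open X opn (fun g => meets g q).
Proof.
  intros g Hg.
  exists (map (fun c => fst (fst c)) q),
    (fun i x => forall f m, In (i, f, m) q -> b i (f i) m x).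
  split; [intro i; apply meets_coordinate_open|split].
  - intros i f m; apply Hg.
  - intros h Hh i f m Hin; apply (Hh i); [|exact Hin].
    now apply (in_map (fun c => fst (fst c))) in Hin.
Qed.

(** * Closing-off: named points, codes and named indices *)

Variables (f0 : forall i, X i) (q0 : list condition).
Hypothesis f0_meets : meets f0 q0.

Definition support_at (n : nat) (f : forall i, X i) (l : list I) : Prop :=
  exists V : forall i, X i -> Prop,
    (forall i, opn i (V i)) /\ (forall i, V i (f i)) /\
    (forall g, (forall i, In i l -> V i (g i)) -> D n g).

(** The indices of [q0] are put in front so that they too become named. *)
Definition support (n : nat) (f : forall i, X i) : list I :=
  map (fun c => fst (fst c)) q0 ++ epsilon (inhabits nil) (support_at n f).

Lemma supportP (n : nat) (f : forall i, X i) : D n f -> support_at n f (support n f).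
Proof.
  intro Hf.
  destruct (epsilon_spec (inhabits nil) (support_at n f)) as (V & HV & HVf & HVD).
  - destruct (D_open n f Hf) as (l & V & H); now exists l, V.
  - exists V; split; [exact HV|split; [exact HVf|]].
    intros g Hg; apply HVD; intros i Hi; apply Hg, in_or_app; now right.
Qed.

(** A Skolem function for the density of [D n]; on an inconsistent [q] its value is arbitrary. *)
Definition point (n : nat) (q : list condition) : forall i, X i :=
  epsilon (inhabits f0) (fun f => D n f /\ meets f q).

Lemma pointP (n : nat) (q : list condition) :
  (exists f, meets f q) -> D n (point n q) /\ meets (point n q) q.
Proof.
  intros [f Hf]; apply (epsilon_spec (inhabits f0) (fun f => D n f /\ meets f q)).
  destruct (D_dense n f _ (@meets_open q) Hf) as [g [Hg1 Hg2]]; now exists g.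
Qed.

(* Names for the finite lists of conditions in the closing-off: a node adds one
   condition, whose index is read off the support of one named point and whose
   center is another named point. *)
Inductive code : Type :=
| base_code
| add_code (n k : nat) (a : code) (n' m : nat) (a' : code) (c : code).

(** A position [k] past the end of the support adds no condition. *)
Fixpoint conds (c : code) : list condition :=
  match c with
  | base_code => q0
  | add_code n k a n' m a' c' =>
      match nth_error (support n (point n (conds a))) k with
      | Some i => (i, point n' (conds a'), m) :: conds c'
      | None => conds c'
      end
  end.

Fixpoint code_to_nat (c : code) : nat :=
  match c with
  | base_code => 0
  | add_code n k a n' m a' c' =>
      S (to_nat (n, to_nat (k, to_nat (n', to_nat (m,
        to_nat (code_to_nat a, to_nat (code_to_nat a', code_to_nat c')))))))
  end.

Lemma to_nat_pair_inj (x y x' y' : nat) :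
  to_nat (x, y) = to_nat (x', y') -> x = x' /\ y = y'.
Proof. intro H; apply to_nat_inj in H; now injection H. Qed.

Lemma code_to_nat_inj (c d : code) : code_to_nat c = code_to_nat d -> c = d.
Proof.
  revert d; induction c as [|n k a IHa n' m a' IHa' c IHc]; intros [|]; cbn [code_to_nat];
    try discriminate; [reflexivity|].
  intro H; apply Nat.succ_inj in H.
  repeat match goal with
         | H : to_nat _ = to_nat _ |- _ =>
             apply to_nat_pair_inj in H; destruct H as [? ?]
         end.
  f_equal; auto.
Qed.

(** Inverts the injective numbering. Countability of the pairs lets one category argument treat
    every dense set and every code. *)
Lemma code_enumeration : exists e : nat -> nat * code, forall p, exists j, e j = p.
Proof.
  exists (fun j => epsilon (inhabits (0, base_code))
                     (fun p => to_nat (fst p, code_to_nat (snd p)) = j)).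
  intros [n c]; exists (to_nat (n, code_to_nat c)).
  match goal with |- epsilon ?i ?P = _ =>
    assert (H : P (epsilon i P)) by (apply epsilon_spec; now exists (n, c));
    destruct (epsilon i P) as [n' c'] end.
  cbn [fst snd] in H; apply to_nat_pair_inj in H; destruct H as [-> H].
  now apply code_to_nat_inj in H as ->.
Qed.

Definition named_index (i : I) : Prop :=
  exists n a, In i (support n (point n (conds a))).

Lemma conds_named (c : code) (i : I) (f : forall i, X i) (m : nat) :
  In (i, f, m) (conds c) -> named_index i.
Proof.
  induction c as [|n k a _ n' m' a' _ c IHc]; simpl.
  - intro H; exists 0, base_code; apply in_or_app; left.
    now apply (in_map (fun c => fst (fst c))) in H.
  - destruct (nth_error _ k) as [j|] eqn:E; [|exact IHc].
    intros [e|H]; [|now apply IHc].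
    injection e as -> _ _; exists n, a; now apply nth_error_In in E.
Qed.

(** The closing-off property: codes are stable under adding a neighborhood of a named point at a
    named index. *)
Lemma add_condition (i : I) (n m : nat) (a c : code) :
  named_index i -> exists c', conds c' = (i, point n (conds a), m) :: conds c.
Proof.
  intros (n' & a' & Hi); apply In_nth_error in Hi; destruct Hi as [k Hk].
  exists (add_code n' k a' n m a c); simpl; now rewrite Hk.
Qed.

(** * Refinement of codes and generic partial points *)

Definition consistent (c : code) : Prop := exists f, meets f (conds c).

Definition refines (c c' : code) : Prop := incl (conds c) (conds c').

Lemma meets_on_refines (s : list I) (g : forall i, X i) (c c' : code) :
  refines c c' -> meets_on s g (conds c') -> meets_on s g (conds c).
Proof. intros H H' i f m Hin; now apply H', H. Qed.

Lemma refines_base (c : code) : refines base_code c.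
Proof.
  induction c as [|n k a _ n' m a' _ c IHc]; [apply incl_refl|].
  unfold refines in *; simpl; destruct (nth_error _ k); [|exact IHc].
  now apply incl_tl.
Qed.

(** The named point of [D n] in the box has a basic neighborhood inside [D n]. Its indices and its
    center are named, so a code describes a smaller box around that point. *)
Lemma refine_into_dense (n : nat) (c : code) :
  consistent c ->
  exists c', refines c c' /\ consistent c' /\ forall h, meets h (conds c') -> D n h.
Proof.
  intro Hc.
  destruct (pointP n Hc) as [HD Hm].
  set (f := point n (conds c)) in *.
  destruct (supportP HD) as (V & HV & HVf & HVD).
  (* The conditions are added one index at a time; [f] stays in every box and so witnesses
     consistency. *)
  assert (H : forall l, incl l (support n f) ->
    exists c', refines c c' /\ meets f (conds c') /\
      forall h, meets h (conds c') -> forall i, In i l -> V i (h i)).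
  { induction l as [|j l IH]; intro Hl.
    - exists c; split; [apply incl_refl|split; [exact Hm|intros h _ i []]].
    - destruct IH as (c1 & Hr & Hf & Hh); [intros i Hi; apply Hl; now right|].
      destruct (b_base j (f j) _ (HV j) (HVf j)) as [m Hb].
      destruct (@add_condition j n m c c1) as [c' Hc'].
      { exists n, c; apply Hl; now left. }
      exists c'; unfold refines; rewrite Hc'; split; [now apply incl_tl|split].
      + intros i f' m' [e|Hin]; [|now apply Hf].
        injection e as <- <- _; apply b_center.
      + intros h Hh' i [<-|Hi].
        * apply Hb, (Hh' j f m); now left.
        * apply Hh; [|exact Hi]. intros i' f' m' Hin; apply Hh'; now right. }
  destruct (H (support n f) (incl_refl _)) as (c' & Hr & Hf & Hh).
  exists c'; split; [exact Hr|split; [now exists f|]].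
  intros h Hh'; now apply HVD, Hh.
Qed.

(* The sections of the sets [D n] at [g] restricted to [s] are dense. *)
Definition generic (s : list I) (g : forall i, X i) : Prop :=
  forall n c, consistent c -> meets_on s g (conds c) ->
    exists c', refines c c' /\ consistent c' /\ meets_on s g (conds c') /\
      forall h, meets h (conds c') -> D n h.

Lemma generic_nil (g : forall i, X i) : generic nil g.
Proof.
  intros n c Hc _; destruct (refine_into_dense n Hc) as (c' & H1 & H2 & H3).
  exists c'; repeat split; trivial; intros i f m _ [].
Qed.

(** * Fixing one more coordinate by Baire category *)

(** The countable set [C i] of the closing-off; the [i]-th coordinate is chosen in its closure. *)
Definition named_coordinate (i : I) (x : X i) : Prop :=
  exists n a, point n (conds a) i = x.

Definition meets_at (i : I) (x : X i) (q : list condition) : Prop :=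
  forall f m, In (i, f, m) q -> b i (f i) m x.

(** Each pair [n], [c1] imposes an open dense requirement on [x] in the closure of the named
    coordinates. Density comes from adding a condition at [i] to [c1], refining into [D n] by
    genericity of [g], and reading off a named point of the refined box. *)
Lemma generic_coordinate (s : list I) (g : forall i, X i) (i : I) (c : code) :
  generic s g -> ~ In i s -> named_index i -> consistent c ->
  exists x : X i, meets_at x (conds c) /\
    forall n c1, consistent c1 -> meets_on s g (conds c1) -> meets_at x (conds c1) ->
      exists c', refines c1 c' /\ consistent c' /\ meets_on s g (conds c') /\
        meets_at x (conds c') /\ forall h, meets h (conds c') -> D n h.
Proof.
  intros Hg Hi Hnamed Hc.
  destruct code_enumeration as [e He].
  set (good := fun n c1 (x : X i) => exists c', refines c1 c' /\ consistent c' /\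
     meets_on s g (conds c') /\ meets_at x (conds c') /\
     forall h, meets h (conds c') -> D n h).
  (* The implication "[x] meets [c1] at [i], hence is good" need not define an
     open set, so its premise is negated on a neighborhood of [x]. *)
  set (E := fun j x => let (n, c1) := e j in
     consistent c1 -> meets_on s g (conds c1) ->
     good n c1 x \/ exists U, opn i U /\ U x /\
       forall y, closure (opn i) (@named_coordinate i) y -> U y -> ~ meets_at y (conds c1)).
  destruct (@hereditarily_Baire_closure _ _ (topo i) (@named_coordinate i) E
              (fun x => meets_at x (conds c))) as (x & Hx & Hxc & HxE).
  - apply hBaire.
  - intro j; apply open_of_nbhd; [apply topo|]; intros x Hx; unfold E in *.
    destruct (e j) as [n c1].
    destruct (classic (consistent c1)) as [H1|H1];
      [|exists (fun _ => True); split; [apply topo|split; tauto]].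
    destruct (classic (meets_on s g (conds c1))) as [H2|H2];
      [|exists (fun _ => True); split; [apply topo|split; tauto]].
    destruct (Hx H1 H2) as [(c' & Hr & Hcc & Hm & Hmx & Hh)|(U & HU & HUx & H)].
    + exists (fun y => meets_at y (conds c')); split; [apply meets_coordinate_open|].
      split; [exact Hmx|]. intros y Hy _ _; left; now exists c'.
    + exists U; split; [exact HU|split; [exact HUx|]].
      intros y Hy _ _; right; now exists U.
  - intros j V y HV Hy HVy; unfold E; destruct (e j) as [n c1].
    assert (Hcl : forall z, named_coordinate z -> closure (opn i) (@named_coordinate i) z)
      by (intros z Hz U _ HUz; now exists z).
    destruct (classic (consistent c1 /\ meets_on s g (conds c1))) as [[H1 H2]|H12];
      [|exists y; split; [now apply Hcl|split; [exact HVy|tauto]]].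
    destruct (classic (exists z, named_coordinate z /\ V z /\ meets_at z (conds c1)))
      as [(z & (n' & a & Hz) & HVz & Hmz)|Hno].
    (* The new condition at [i] forces the [i]-th coordinate into [V]. Moving a witness for [c1] to
       [z] at [i] keeps the code consistent, and [g] is not affected since [i] is outside [s]. *)
    + destruct (b_base i z _ HV HVz) as [m Hb].
      destruct (add_condition n' m a c1 Hnamed) as [c2 Hc2].
      destruct (Hg n c2) as (c' & Hr & Hcc & Hm & Hh).
      * destruct H1 as [f Hf]. destruct (dependent_update X f i z) as (f' & Hf'i & Hf'j).
        exists f'; rewrite Hc2; intros k f1 m1 [e1|Hin].
        -- injection e1 as <- <- <-; rewrite Hz, Hf'i; apply b_center.
        -- destruct (classic (k = i)) as [->|Hk].
           ++ rewrite Hf'i; now apply Hmz.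
           ++ rewrite Hf'j by exact Hk; now apply Hf.
      * rewrite Hc2; intros k f1 m1 [e1|Hin] Hk; [|now apply H2].
        injection e1 as <- _ _; contradiction.
      (* Any dense set would do here: only membership in the box matters. *)
      * destruct (pointP 0 Hcc) as [_ Hp].
        exists (point 0 (conds c') i); split; [apply Hcl; now exists 0, c'|].
        assert (Hr2 : incl (conds c2) (conds c')) by exact Hr.
        rewrite Hc2 in Hr2.
        split.
        -- apply Hb; rewrite <- Hz; apply Hp, Hr2; now left.
        -- intros _ _; left; exists c'; split; [|split; [exact Hcc|split; [exact Hm|split]]].
           ++ intros q Hq; apply Hr2; now right.
           ++ intros f1 m1; apply Hp.
           ++ exact Hh.
    + exists y; split; [now apply Hcl|split; [exact HVy|]].
      intros _ _; right; exists V; split; [exact HV|split; [exact HVy|]].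
      (* A closure point in [V] meeting [c1] would have a named coordinate with both properties
         nearby. *)
      intros z Hz HVz Hmz; apply Hno.
      destruct (Hz (fun w => V w /\ meets_at w (conds c1))) as (w & [Hw1 Hw2] & Hw);
        [|now split|now exists w].
      apply open_inter; [apply topo|exact HV|apply meets_coordinate_open].
  - apply meets_coordinate_open.
  - exists (point 0 (conds c) i); split; [now exists 0, c|].
    destruct (pointP 0 Hc) as [_ Hp]; intros f m; apply Hp.
  - exists x; split; [exact Hxc|].
    intros n c1 H1 H2 H3; destruct (He (n, c1)) as [j Hj].
    specialize (HxE j); unfold E in HxE; rewrite Hj in HxE.
    destruct (HxE H1 H2) as [H|(U & HU & HUx & H)]; [exact H|].
    (* The second alternative fails at [x], which lies in the closure and in [U] and meets [c1]. *)
    exfalso; now apply (H x).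
Qed.

(** * Extending generic partial points and passing to the limit *)

Lemma generic_extend (s : list I) (g : forall i, X i) (i : I) (c : code) :
  generic s g -> named_index i -> consistent c -> meets_on s g (conds c) ->
  exists g', generic (i :: s) g' /\ meets_on (i :: s) g' (conds c) /\
    forall j, In j s -> g' j = g j.
Proof.
  intros Hg Hnamed Hc Hm.
  destruct (classic (In i s)) as [Hi|Hi].
  - assert (H : forall q, meets_on (i :: s) g q <-> meets_on s g q).
    { intro q; split; intros H k f m Hin Hk; apply H; trivial; [now right|].
      destruct Hk as [<-|Hk]; trivial. }
    exists g; split; [|split; [now apply H|trivial]].
    intros n c1 H1 H2; apply H in H2.
    destruct (Hg n c1 H1 H2) as (c' & Hr & Hcc & Hm' & Hh).
    exists c'; split; [exact Hr|split; [exact Hcc|split; [now apply H|exact Hh]]].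
  - destruct (generic_coordinate Hg Hi Hnamed Hc) as (x & Hx & Hgen).
    destruct (dependent_update X g i x) as (g' & Hi' & Hj').
    assert (Hs : forall j, In j s -> g' j = g j)
      by (intros j Hj; apply Hj'; intros ->; contradiction).
    assert (H : forall q, meets_on (i :: s) g' q <-> meets_on s g q /\ meets_at x q).
    { intro q; split.
      - intro H; split.
        + intros k f m Hin Hk; rewrite <- Hs by exact Hk; apply H; [exact Hin|now right].
        + intros f m Hin; rewrite <- Hi'; apply H; [exact Hin|now left].
      - intros [H1 H2] k f m Hin [<-|Hk].
        + rewrite Hi'; now apply H2.
        + rewrite Hs by exact Hk; now apply H1. }
    exists g'; split; [|split; [now apply H|exact Hs]].
    intros n c1 H1 H2; apply H in H2; destruct H2 as [H2 H3].
    destruct (Hgen n c1 H1 H2 H3) as (c' & Hr & Hcc & Hm' & Hx' & Hh).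
    exists c'; split; [exact Hr|split; [exact Hcc|split; [now apply H|exact Hh]]].
Qed.

Lemma generic_extend_list (l s : list I) (g : forall i, X i) (c : code) :
  (forall i, In i l -> named_index i) ->
  generic s g -> consistent c -> meets_on s g (conds c) ->
  exists g', generic (l ++ s) g' /\ meets_on (l ++ s) g' (conds c) /\
    forall j, In j s -> g' j = g j.
Proof.
  induction l as [|i l IH]; intros Hl Hg Hc Hm; [now exists g|].
  destruct IH as (g1 & Hg1 & Hm1 & H1); trivial; [intros j Hj; apply Hl; now right|].
  destruct (generic_extend Hg1 (Hl i (or_introl eq_refl)) Hc Hm1) as (g' & Hg' & Hm' & H').
  exists g'; split; [exact Hg'|split; [exact Hm'|]].
  intros j Hj; rewrite H' by (apply in_or_app; now right); now apply H1.
Qed.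

(** The box of [q0] is refined into [D n] compatibly with [g], then all its finitely many indices
    are fixed inside it; any point agreeing with [g'] there lies in the refined box. *)
Lemma generic_step (n : nat) (s : list I) (g : forall i, X i) :
  generic s g -> meets_on s g q0 ->
  exists s' g', generic s' g' /\ meets_on s' g' q0 /\ incl s s' /\
    (forall j, In j s -> g' j = g j) /\
    forall h, (forall j, In j s' -> h j = g' j) -> D n h /\ meets h q0.
Proof.
  intros Hg Hm.
  destruct (Hg n base_code (ex_intro _ f0 f0_meets) Hm) as (c & _ & Hc & Hmc & Hh).
  set (l := map (fun q : condition => fst (fst q)) (conds c)).
  destruct (@generic_extend_list l s g c) as (g' & Hg' & Hm' & Hs); trivial.
  { intros i Hi; apply in_map_iff in Hi; destruct Hi as [[[j f] m] [<- Hin]].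
    now apply conds_named in Hin. }
  exists (l ++ s), g'; split; [exact Hg'|split; [|split; [now apply incl_appr, incl_refl|split]]].
  - exact (meets_on_refines (refines_base c) Hm').
  - exact Hs.
  - intros h Hhg.
    assert (H : meets h (conds c)).
    { intros i f m Hin.
      assert (Hi : In i (l ++ s)).
      { apply in_or_app; left; now apply (in_map (fun q => fst (fst q))) in Hin. }
      rewrite Hhg by exact Hi; now apply Hm'. }
    split; [now apply Hh|].
    intros i f m Hin; now apply H, refines_base.
Qed.

Lemma dense_intersection_point : exists h, meets h q0 /\ forall n, D n h.
Proof.
  destruct (@dependent_choice (list I * (forall i, X i))
    (fun a => generic (fst a) (snd a) /\ meets_on (fst a) (snd a) q0)
    (fun n a a' => incl (fst a) (fst a') /\
      (forall j, In j (fst a) -> snd a' j = snd a j) /\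
      forall h, (forall j, In j (fst a') -> h j = snd a' j) -> D n h /\ meets h q0)
    (nil, f0)) as [a Ha].
  - split; [apply generic_nil|intros i f m _ []].
  - intros n [s g] [Hg Hm].
    destruct (generic_step n Hg Hm) as (s' & g' & H).
    exists (s', g'); simpl in *; tauto.
  - assert (Hmono : forall n k j, In j (fst (a n)) ->
              In j (fst (a (k + n))) /\ snd (a (k + n)) j = snd (a n) j).
    { intros n k j Hj; induction k as [|k [IH1 IH2]]; [now split|].
      destruct (Ha (k + n)) as (_ & Hincl & Heq & _); split.
      - now apply Hincl.
      - simpl; rewrite Heq; trivial. }
    (* Some stage at which coordinate [i] is already fixed; for an index never fixed the value is
       arbitrary and harmless. *)
    set (stage := fun i => epsilon (inhabits 0) (fun n => In i (fst (a n)))).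
    assert (Hh : forall n j, In j (fst (a n)) -> snd (a (stage j)) j = snd (a n) j).
    { intros n j Hj.
      assert (Hst : In j (fst (a (stage j)))) by (apply epsilon_spec; now exists n).
      (* Both values are compared with the one at the common later stage [stage j + n]. *)
      rewrite <- (proj2 (Hmono n (stage j) j Hj)), <- (proj2 (Hmono _ n j Hst)).
      now rewrite Nat.add_comm. }
    assert (HD : forall n, D n (fun j => snd (a (stage j)) j) /\
                           meets (fun j => snd (a (stage j)) j) q0).
    { intro n; destruct (Ha n) as (_ & _ & _ & H); apply H; apply Hh. }
    exists (fun j => snd (a (stage j)) j); split; [apply (HD 0)|intro n; apply HD].
Qed.

End Product.

(** * Choosing neighborhood bases in the factors and a box inside the given open set *)

Theorem theorem4p2 (I : Type) (X : I -> Type) (opn : forall i, opens (X i)) :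
  (forall i, is_topology (opn i)) ->
  (forall i, R0_space (opn i)) ->
  (forall i, hereditarily_Baire (opn i)) ->
  (forall i, has_BCO (opn i)) ->
  Baire (@product_open I X opn).
Proof.
  intros topo _ hB hBCO D HDo HDd f U HU HUf.
  set (nb := fun i x (b : nat -> X i -> Prop) =>
    (forall m, opn i (b m)) /\ (forall m, b m x) /\
    (forall U, opn i U -> U x -> exists m, forall y, b m y -> U y)).
  set (b := fun i x => epsilon (inhabits (fun _ _ => True)) (nb i x)).
  assert (Hb : forall i x, nb i x (b i x)).
  { intros i x; apply epsilon_spec; exact (BCO_first_countable (topo i) x (hBCO i)). }
  destruct (HU f HUf) as (l & V & HV & HVf & HVU).
  (* The radii shrink the given box around [f] to one made of chosen neighborhoods, which [q0] can
     encode. *)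
  set (rad := fun i => epsilon (inhabits 0) (fun m => forall y, b i (f i) m y -> V i y)).
  assert (Hrad : forall i y, b i (f i) (rad i) y -> V i y).
  { intro i.
    apply (epsilon_spec (inhabits 0) (fun m => forall y, b i (f i) m y -> V i y)).
    now apply Hb. }
  destruct (@dense_intersection_point I X opn topo hB b) with
    (D := D) (f0 := f) (q0 := map (fun i => (i, f, rad i)) l) as (h & Hh & HDh); trivial.
  - intros i x m; apply Hb.
  - intros i x m; apply Hb.
  - intros i x W; apply Hb.
  - intros i f' m Hin; apply in_map_iff in Hin; destruct Hin as (j & e & _).
    injection e as -> <- _; apply Hb.
  - exists h; split; [|exact HDh].
    apply HVU; intros i Hi; apply Hrad, Hh.
    apply in_map_iff; now exists i.
Qed.
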